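(* Let $G$ be a nontrivial finite abelian $p$-group for some prime $p$. Then $\delta(\mathcal{G}(G))=\tau(G)-1$.
   Context: A $p$-group is a finite group whose order is a power of $p$. A finite abelian group $G$ is isomorphic to a unique (up to order of factors) direct product of cyclic groups of prime power order; $\tau(G)$ denotes the order of the smallest cyclic factor in this decomposition. The power graph $\mathcal{G}(G)$ has vertex set $G$, distinct $u,v$ adjacent iff one is a positive integer power of the other; $\delta$ denotes minimum degree. *)

(* Defs.v *)
From mathcomp Require Import all_boot all_fingroup all_solvable.

Set Implicit Arguments.
Unset Strict Implicit.
Unset Printing Implicit Defensive.

Import GroupScope.

(* A finite simple graph on a subset of an ambient finite type; [adjacent] is
   only meaningful between elements of [vertices]. *)
Record sgraph (T : finType) := SGraph {
  vertices : {set T};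
  adjacent : rel T;
  adjacent_sym : symmetric adjacent;
  adjacent_irr : irreflexive adjacent
}.

Definition degree (T : finType) (X : sgraph T) (u : T) : nat :=
  #|[set v in vertices X | adjacent X u v]|.

(* Every degree is < #|vertices X|, so when X has a vertex the default value of
   the iterated minimum plays no role. *)
Definition min_degree (T : finType) (X : sgraph T) : nat :=
  \big[minn/#|vertices X|]_(u in vertices X) degree X u.

Lemma min_degree_leq (T : finType) (X : sgraph T) u :
  u \in vertices X -> min_degree X <= degree X u.
Proof.
rewrite /min_degree => Xu; have := mem_index_enum u.
elim: (index_enum T) => // v s IHs; rewrite inE big_cons.
case/predU1P => [<-|/IHs le_u]; first by rewrite Xu geq_minl.
by case: ifP => // _; rewrite geq_min le_u orbT.
Qed.

Lemma min_degree_attained (T : finType) (X : sgraph T) :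
  vertices X != set0 -> exists2 u, u \in vertices X & min_degree X = degree X u.
Proof.
case/set0Pn=> u0 Xu0; have ltd u : u \in vertices X -> degree X u < #|vertices X|.
  move=> Xu; apply/proper_card/properP; split; last first.
    by exists u; rewrite // inE Xu adjacent_irr.
  by apply/subsetP=> v; rewrite inE => /andP[].
suff [//|eqn] : (exists2 u, u \in vertices X & min_degree X = degree X u)
    \/ min_degree X = #|vertices X|.
  by have := min_degree_leq Xu0; rewrite eqn leqNgt ltd.
rewrite /min_degree.
elim/big_rec: _ => [|u m Xu IH]; first by right.
case: (leqP (degree X u) m) => [le_um | lt_mu].
  by left; exists u.
by case: IH => [[v Xv ->]|->]; [left; exists v | right].
Qed.

(* The exponents 1, ..., #[v] already produce all positive powers of v. *)
Definition positive_power (gT : finGroupType) (u v : gT) : bool :=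
  [exists n : 'I_#[v], u == v ^+ n.+1].

Lemma positive_powerP (gT : finGroupType) (u v : gT) :
  reflect (exists2 n, 0 < n & u = v ^+ n) (positive_power u v).
Proof.
apply: (iffP existsP) => [[n /eqP->] | [[//|n] _ ->]]; first by exists n.+1.
exists (Ordinal (ltn_pmod n (order_gt0 v))) => /=.
by rewrite !expgS expg_mod_order.
Qed.

Definition power_adjacent (gT : finGroupType) : rel gT :=
  fun u v => (u != v) && (positive_power u v || positive_power v u).

Lemma power_adjacent_sym (gT : finGroupType) :
  symmetric (@power_adjacent gT).
Proof. by move=> u v; rewrite /power_adjacent eq_sym orbC. Qed.

Lemma power_adjacent_irr (gT : finGroupType) :
  irreflexive (@power_adjacent gT).
Proof. by move=> u; rewrite /power_adjacent eqxx. Qed.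

Definition power_graph (gT : finGroupType) (G : {group gT}) : sgraph gT :=
  SGraph (G : {set gT}) (@power_adjacent_sym gT) (@power_adjacent_irr gT).

Definition prime_power (n : nat) : bool := (1 < n) && (pdiv n).-nat n.

Lemma prime_powerP (n : nat) :
  reflect (exists2 p, prime p & exists k, n = (p ^ k.+1)%N) (prime_power n).
Proof.
apply: (iffP andP) => [[n_gt1 /p_natP[k nE]] | [p p_pr [k ->]]].
  exists (pdiv n); first exact: pdiv_prime.
  by case: k nE => [nE | k nE]; [rewrite nE in n_gt1 | exists k].
split; last by rewrite pdiv_pfactor // pnatX pnat_id.
by rewrite -(exp1n k.+1) ltn_exp2r ?prime_gt1.
Qed.

(* b lists generators of the cyclic factors of an (internal) direct product
   decomposition of G into cyclic groups of prime power order > 1. *)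
Definition primary_decomposition (gT : finGroupType) (G : {group gT})
    (b : seq gT) : bool :=
  (\big[dprod/1]_(x <- b) <[x]> == G :> {set gT})
    && all (fun x => prime_power #[x]) b.

Lemma primary_decomposition_exists (gT : finGroupType) (G : {group gT}) :
  abelian G -> exists b, primary_decomposition G b.
Proof.
have [n] := ubnP #|G|; elim: n G => // n IHn G leGn cGG.
have [G1 | ntG] := eqVneq (G : {set gT}) 1.
  by exists [::]; rewrite /primary_decomposition big_nil G1 eqxx.
pose p := pdiv #|G|.
have G_gt1 : 1 < #|G| by rewrite cardG_gt1.
have p_pr : prime p by apply: pdiv_prime.
have nilG := abelian_nil cGG.
have defG := nilpotent_pcoreC p nilG.
have [| |b' /andP[/eqP defb' b'pp]] := IHn 'O_p^'(G)%G.
- rewrite -ltnS; apply: leq_trans leGn; rewrite ltnS -(dprod_card defG).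
  rewrite ltn_Pmull //.
  rewrite (card_Hall (nilpotent_pcore_Hall p nilG)) p_part_gt1.
  by rewrite pi_pdiv.
- exact: abelianS (pcore_sub _ _) cGG.
have [b defb ob] := abelian_structure (abelianS (pcore_sub p G) cGG).
exists (b ++ b'); rewrite /primary_decomposition big_cat /= defb defb' defG eqxx.
rewrite all_cat b'pp andbT; apply/allP => x b_x; apply/prime_powerP; exists p => //.
have x_gt1 : 1 < #[x].
  by apply: (allP (abelian_type_gt1 'O_p(G))); rewrite -ob map_f.
have pE : p.-nat #[x].
  have: <[x]> \subset 'O_p(G).
    have := bigdprodWY defb; rewrite (big_rem x) //= => <-.
    exact: joing_subl.
  by move/pgroupS; apply; apply: pcore_pgroup.
have [k oxE] := p_natP pE.
by case: k oxE => [oxE | k ->]; [rewrite oxE in x_gt1 | exists k].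
Qed.

Lemma primary_decomposition_unique (gT : finGroupType) (G : {group gT})
    (b c : seq gT) :
    primary_decomposition G b -> primary_decomposition G c ->
  perm_eq (map order b) (map order c).
Proof.
have cntE (d : seq gT) p k : prime p -> primary_decomposition G d ->
    (count_mem (p ^ k.+1)%N (map order d) +
      logn p #|'Ohm_k.+2(G) : 'Ohm_k.+1(G)|)%N
      = logn p #|'Ohm_k.+1(G) : 'Ohm_k(G)|.
  move=> p_pr /andP[/eqP defG /allP dpp].
  rewrite -!(count_logn_dprod_cycle _ _ defG) count_map -count_predUI.
  rewrite (@eq_in_count _ (predI _ _) pred0) ?count_pred0 ?addn0; last first.
    move=> x _ /=; case: eqP => //= ->.
    by rewrite pfactorK // ltnn.
  apply: eq_in_count => x /dpp/prime_powerP[q q_pr [j oxE]] /=; rewrite oxE.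
  have [<- | neq_qp] := eqVneq q p.
    by rewrite pfactorK // eqn_exp2l ?prime_gt1 // eqSS ltnS [RHS]leq_eqVlt eq_sym.
  rewrite lognX (logn_prime _ q_pr) [p == q]eq_sym (negbTE neq_qp) muln0 orbF.
  apply/eqP => eq_qp; case/eqP: neq_qp; apply/eqP.
  have: q %| (p ^ k.+1)%N by rewrite -eq_qp dvdn_exp.
  by rewrite Euclid_dvdX // andbT dvdn_prime2.
move=> bG cG; apply/allP => q _ /=; apply/eqP.
have [/prime_powerP[p p_pr [k ->]] | npp] := boolP (prime_power q).
  by apply/eqP; rewrite -(eqn_add2r (logn p #|'Ohm_k.+2(G) : 'Ohm_k.+1(G)|)) !cntE.
have z d : primary_decomposition G d -> count_mem q (map order d) = 0.
  case/andP=> _ /allP dpp; apply/count_memPn/mapP => [[x /dpp xpp qE]].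
  by rewrite qE xpp in npp.
by rewrite !z.
Qed.

(* The default 1 is only reached for the trivial group, which has no cyclic
   factor. *)
Definition tau (gT : finGroupType) (G : {group gT}) (cGG : abelian G) : nat :=
  head 1%N (sort leq (map order (xchoose (primary_decomposition_exists cGG)))).

Lemma tauE (gT : finGroupType) (G : {group gT}) (cGG : abelian G) (b : seq gT) :
  primary_decomposition G b -> tau cGG = head 1%N (sort leq (map order b)).
Proof.
move=> bG; congr head; apply/perm_sortP; first exact: leq_total.
- exact: leq_trans.
- exact: anti_leq.
exact: primary_decomposition_unique (xchooseP _) bG.
Qed.

Arguments tau {gT} G cGG.

(* Main.v *)
(** In a decomposition of [G] into cyclic factors, a generator [x] of a factor
  is not a [p]-th power, so its neighbours are the other elements of [<[x]>];
  for a smallest factor this gives degree [tau G - 1]. Conversely any [u] lies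
  in a cyclic [<[w]>] of maximal order; [w] is then not a [p]-th power, so one
  of its coordinates generates a factor and [#[w] >= tau G]. Subgroups of the
  cyclic [p]-group [<[w]>] form a chain, so [u] is adjacent to all its other
  elements. *)

Require Import Defs.
From mathcomp Require Import all_boot all_fingroup all_solvable.
Import GroupScope.

Set Implicit Arguments.
Unset Strict Implicit.

Lemma positive_power_cycle (gT : finGroupType) (u v : gT) :
  positive_power u v = (u \in <[v]>).
Proof.
apply/positive_powerP/idP => [[n _ ->] | /cycleP[n ->]]; first exact: mem_cycle.
(* Adding [#[v]] keeps the power and makes the exponent positive even when [n = 0]. *)
exists (n + #[v])%N; first by rewrite addn_gt0 order_gt0 orbT.
by rewrite expgD expg_order mulg1.
Qed.

(** Inside a cyclic group, membership in [<[y]>] amounts to divisibility of orders, and powers of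
    [p] are totally ordered by divisibility. *)
Lemma cycle_pgroup_total (gT : finGroupType) (p : nat) (w u v : gT) :
    prime p -> p.-elt w -> u \in <[w]> -> v \in <[w]> ->
  (u \in <[v]>) || (v \in <[u]>).
Proof.
move=> p_pr pw wu wv; have cw := cycle_cyclic w.
have sub x y : x \in <[w]> -> y \in <[w]> -> (x \in <[y]>) = (#[x] %| #[y]).
  by move=> wx wy; rewrite -cycle_subG -(cardSg_cyclic cw) ?cycle_subG.
have [i oi] := p_natP (mem_p_elt pw wu).
have [j oj] := p_natP (mem_p_elt pw wv).
by rewrite (sub u v) // (sub v u) // oi oj !dvdn_Pexp2l ?prime_gt1 // leq_total.
Qed.

Lemma dprod_cycle_mem (gT : finGroupType) (G : {group gT}) (x : gT)
    (A : {set gT}) (w : gT) :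
    <[x]> \x A = G -> w \in G ->
  exists K : {group gT}, exists i z,
    [/\ A = K, w = x ^+ i * z, z \in K & commute (x ^+ i) z].
Proof.
move=> defG Gw; have [[_ K _ defK] _ _ _] := dprodP defG; subst A.
have [y [z [/cycleP[i ->] Kz -> _]]] := mem_dprod defG Gw.
exists K, i, z; split=> //; have [_ _ cxK _] := dprodP defG.
by apply/esym/(centsP cxK); rewrite ?mem_cycle.
Qed.

Lemma cycle_dprod_expg_inj (gT : finGroupType) (G K : {group gT}) (x z : gT)
    (i j : nat) :
  <[x]> \x K = G -> z \in K -> x ^+ i * z = x ^+ j -> x ^+ i = x ^+ j /\ z = 1.
Proof.
move=> /dprodP[_ _ _ tixK] Kz eqx.
have z1 : z = 1.
  have: z \in <[x]> :&: K; last by rewrite tixK => /set1P.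
  by rewrite inE Kz andbT -(mulKg (x ^+ i) z) eqx groupM ?groupV ?mem_cycle.
by rewrite z1 mulg1 in eqx *.
Qed.

(** If [w] has coordinate [x ^+ i] along [<[x]>], then [w ^+ p = x] would give [i * p = 1] modulo
    [#[x]], hence modulo [p], which is absurd. *)
Lemma dprod_generator_not_expg (gT : finGroupType) (G : {group gT})
    (p : nat) (b : seq gT) (x w : gT) :
    prime p -> \big[dprod/1]_(y <- b) <[y]> = G -> x \in b -> p %| #[x] ->
  w \in G -> w ^+ p != x.
Proof.
move=> p_pr defG bx p_x Gw; apply/eqP => wpx.
rewrite (big_rem x) //= in defG.
have [K [i [z [defK wE Kz cxz]]]] := dprod_cycle_mem defG Gw.
rewrite defK in defG.
have [|eqx _] := cycle_dprod_expg_inj (i := (i * p)%N) (j := 1) defG (groupX p Kz).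
  by rewrite expgM expg1 -expgMn // -wE.
have /eqP := eqx; rewrite eq_expg_mod_order => eqip.
have: (i * p == 1 %[mod p])%N.
  by rewrite -(modn_dvdm (i * p)%N p_x) (eqP eqip) modn_dvdm.
by rewrite modnMl modn_small ?prime_gt1.
Qed.

(** The root is extracted coordinate by coordinate: if [x ^+ i] is killed by [p ^ e] while
    [p ^ e.+1] divides [#[x]], then [p] divides [i]. *)
Lemma dprod_cycle_expg (gT : finGroupType) (p e : nat) (b : seq gT)
    (G : {group gT}) (w : gT) :
    0 < p -> \big[dprod/1]_(y <- b) <[y]> = G ->
    {in b, forall y, (p ^ e.+1 %| #[y])%N} ->
  w \in G -> w ^+ (p ^ e)%N = 1 -> exists2 v, v \in G & w = v ^+ p.
Proof.
move=> p_gt0; elim: b G w => [|x b IHb] G w.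
  by rewrite big_nil => <- _ /set1P-> _; exists 1; rewrite ?expg1n ?group1.
rewrite big_cons => defG ob Gw.
have [K [i [z [defK wE Kz cxz]]]] := dprod_cycle_mem defG Gw.
rewrite defK in defG; rewrite wE expgMn // -expgM => /esym w1.
have [xi zi] : x ^+ (i * p ^ e)%N = x ^+ 0 /\ z ^+ (p ^ e)%N = 1.
  by apply: (cycle_dprod_expg_inj defG); rewrite ?groupX.
have [v Kv zE] : exists2 v, v \in K & z = v ^+ p.
  by apply: IHb => // y b_y; apply: ob; rewrite inE b_y orbT.
have /dvdnP[j iE] : p %| i.
  have: (p ^ e.+1 %| i * p ^ e)%N.
    by apply: dvdn_trans (ob x (mem_head _ _)) _; rewrite order_dvdn xi.
  by rewrite expnS dvdn_pmul2r // expn_gt0 p_gt0.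
have [_ defxK cxK _] := dprodP defG.
exists (x ^+ j * v); first by rewrite -defxK mem_mulg ?mem_cycle.
rewrite expgMn; last by apply/esym/(centsP cxK); rewrite ?mem_cycle.
by rewrite -expgM -iE -zE.
Qed.

Lemma mem_large_cycle (gT : finGroupType) (G : {group gT}) (p e : nat)
    (b : seq gT) (u : gT) :
    prime p -> p.-group G -> G :!=: 1 -> \big[dprod/1]_(y <- b) <[y]> = G ->
    {in b, forall y, (p ^ e.+1 %| #[y])%N} -> u \in G ->
  exists2 w, w \in G & (u \in <[w]>) && (p ^ e.+1 <= #[w])%N.
Proof.
move=> p_pr pG ntG defG ob Gu.
have [|w /andP[Gw wu] maxw] :=
  @arg_maxnP _ u (fun w => (w \in G) && (u \in <[w]>)) (@order gT).
  by rewrite Gu cycle_id.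
exists w; rewrite // wu leqNgt; apply/negP => lt_w.
(* The order of [w] is a power of [p] below [p ^ e.+1], so it divides [p ^ e]. *)
have w1 : w ^+ (p ^ e)%N = 1.
  have [k ok] := p_natP (mem_p_elt pG Gw).
  apply/eqP; rewrite -order_dvdn ok dvdn_exp2l //.
  by rewrite -ltnS -(ltn_exp2l _ _ (prime_gt1 p_pr)) -ok.
have [v Gv wE] := dprod_cycle_expg (prime_gt0 p_pr) defG ob Gw w1.
have le_vw : #[v] <= #[w].
  apply: maxw; rewrite Gv (subsetP _ _ wu) //.
  by rewrite cycle_subG wE mem_cycle.
(* Otherwise [#[v]] would be [p] times [#[w]], against the maximality of [#[w]]. *)
have v1 : v = 1.
  apply/eqP; rewrite -order_eq1.
  have [[|k] ok] := p_natP (mem_p_elt pG Gv); first by rewrite ok.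
  move: le_vw; rewrite wE orderXdiv ok ?dvdn_exp // leqNgt ltn_Pdiv ?prime_gt1 //.
  by rewrite expn_gt0 prime_gt0.
(* Now [w = 1] and so [u = 1], which lies in every cycle: a nontrivial [g] beats the maximal
   order. *)
case/trivgPn: ntG => g Gg; rewrite -order_gt1 ltnNge => /negP[].
have w_eq1 : w = 1 by rewrite wE v1 expg1n.
rewrite -[1%N](order1 gT) -[X in (_ <= #[X])%N]w_eq1; apply: maxw.
by move: wu; rewrite w_eq1 cycle1 => /set1P->; rewrite Gg group1.
Qed.

(** Counting [u] along with its neighbours removes the condition that the two vertices differ and
    absorbs the [- 1] of the final formula. *)
Lemma degree_power_graph (gT : finGroupType) (G : {group gT}) (u : gT) :
  u \in G ->
  (degree (power_graph G) u).+1
    = #|[set v in G | (u \in <[v]>) || (v \in <[u]>)]|.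
Proof.
move=> Gu; rewrite (cardsD1 u) inE Gu cycle_id add1n; congr _.+1.
apply: eq_card => v; rewrite !inE /= /power_adjacent !positive_power_cycle.
by rewrite eq_sym; do !bool_congr.
Qed.

(** Let [x = v ^+ i]. If [p] divides [i], then [x] is a [p]-th power, which is excluded; otherwise
    [i] is prime to [#[v]], so [x] generates [<[v]>] and [v] already lies in [<[x]>]. *)
Lemma degree_dprod_generator (gT : finGroupType) (G : {group gT}) (p : nat)
    (b : seq gT) (x : gT) :
    prime p -> p.-group G -> \big[dprod/1]_(y <- b) <[y]> = G -> x \in b ->
    p %| #[x] -> x \in G ->
  (degree (power_graph G) x).+1 = #[x].
Proof.
move=> p_pr pG defG bx p_x Gx; rewrite degree_power_graph //.
apply: eq_card => v; rewrite inE; apply/andP/idP => [[Gv] | xv]; last first.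
  by rewrite xv orbT (subsetP _ _ xv) ?cycle_subG.
case/orP=> // /cycleP[i xE]; have [/dvdnP[j iE] | p'i] := boolP (p %| i).
  have /negP[] := dprod_generator_not_expg p_pr defG bx p_x (groupX j Gv).
  by rewrite -expgM -iE -xE.
suff /eqP<- : generator <[v]> x by apply: cycle_id.
rewrite xE generator_coprime.
by apply: pnat_coprime (mem_p_elt pG Gv) _; rewrite p'natE.
Qed.

Unset Implicit Arguments.
Set Strict Implicit.

Theorem theorem5p1 (gT : finGroupType) (G : {group gT}) (p : nat)
    (p_pr : prime p) (pG : p.-group G) (cGG : abelian G) (ntG : G :!=: 1) :
  min_degree (power_graph G) = (tau G cGG - 1)%N.
Proof.
have [b bG] := primary_decomposition_exists cGG.
rewrite (tauE _ bG); case/andP: bG => /eqP defG /allP bpp.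
have bsub y : y \in b -> y \in G.
  move=> b_y; rewrite -cycle_subG -(bigdprodWY defG) (big_rem y) //=.
  exact: joing_subl.
have bo y : y \in b -> exists k, #[y] = (p ^ k.+1)%N.
  move=> b_y; have [[|k] ok] := p_natP (mem_p_elt pG (bsub y b_y)).
    by have := bpp y b_y; rewrite ok.
  by exists k.
have [x bx [-> minx]] : exists2 x, x \in b &
    head 1%N (sort leq (map order b)) = #[x] /\ {in b, forall y, #[x] <= #[y]}.
  have := sort_sorted leq_total (map order b).
  have := mem_sort leq (map order b).
  case: (sort _ _) => [|m s] memb /=.
    (* The default of [head] would require [b] to be empty, making [G] trivial. *)
    case: b {bsub bo bpp} defG memb => [|y b] defG memb.
      by case/eqP: ntG; rewrite -defG big_nil.
    by have := memb #[y]; rewrite mem_head.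
  rewrite (path_sortedE leq_trans) => /andP[/allP le_m _].
  have /mapP[x bx mE] : m \in map order b by rewrite -memb mem_head.
  exists x; rewrite // -mE; split=> // y b_y.
  have: #[y] \in m :: s by rewrite memb map_f.
  by case/predU1P=> [->|/le_m].
have [e xE] := bo x bx; have Gx := bsub x bx.
have degx : (degree (power_graph G) x).+1 = #[x].
  by apply: (degree_dprod_generator p_pr pG defG) => //; rewrite xE dvdn_exp.
(* The vertex [x] gives the upper bound; the lower bound is checked at a vertex [u] of minimum
   degree. *)
rewrite -degx subn1; apply/eqP; rewrite eqn_leq min_degree_leq //=.
have [|u Gu ->] := @min_degree_attained _ (power_graph G).
  by apply/set0Pn; exists x.
rewrite -ltnS degx degree_power_graph // xE.
have [|w Gw /andP[wu /leq_trans-> //]] :=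
  @mem_large_cycle _ G p e b u p_pr pG ntG defG _ Gu.
  (* Among powers of [p], the smallest order [#[x]] divides all the others. *)
  move=> y b_y; have := minx y b_y; have [k ->] := bo y b_y; rewrite xE.
  by rewrite leq_exp2l ?prime_gt1 // => /dvdn_exp2l->.
(* All of [<[w]>] lies in the closed neighbourhood of [u]. *)
apply/subset_leq_card/subsetP => v wv; rewrite inE.
rewrite (cycle_pgroup_total p_pr (mem_p_elt pG Gw)) // andbT.
by apply: subsetP wv; rewrite cycle_subG.
Qed.
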